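(* Let $F$ be a forest on $n$ vertices and let $k \geq 2$ be an integer. Suppose $n^{1/3} \geq 2k - 1$. Then \[ f_k(F) \leq (2k-1) \lfloor n^{1/3} \rfloor. \]
   Context: All graphs are finite and simple. For a graph $G$ and an integer $k \geq 2$, $f_k(G)$ denotes the minimum number of vertices that must be deleted from $G$ to obtain an induced subgraph $H$ in which at least $k$ vertices have degree $\Delta(H)$ (the maximum degree of $H$), or otherwise $|H| < k$, where $|H|$ is the number of vertices of $H$. *)

(* Defs.v *)
From mathcomp Require Import all_boot.
Set Implicit Arguments.
Unset Strict Implicit.
Unset Printing Implicit Defensive.

(* A finite simple graph is a symmetric irreflexive relation [e] on a finType;
   its induced subgraphs are identified with their vertex sets [A]. *)
Section Graph.
Variables (T : finType) (e : rel T).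

Definition simple_graph : Prop := symmetric e /\ irreflexive e.

(* For symmetric [e], every edge gives a [ucycle] of length 2, so graph cycles
   are those of length at least 3. *)
Definition forest : Prop :=
  simple_graph /\ forall c : seq T, 3 <= size c -> ~ ucycle e c.

Definition deg_in (A : {set T}) (x : T) : nat := #|[set y in A | e x y]|.

Definition max_deg (A : {set T}) : nat := \max_(x in A) deg_in A x.

Definition k_max_deg (k : nat) (A : {set T}) : bool :=
  (k <= #|[set x in A | deg_in A x == max_deg A]|) || (#|A| < k).

(* [D] is the set of deleted vertices. Deleting everything is always
   admissible ([k_max_deg_setC_setT]), so the arg min is a genuine minimum. *)
Definition f_ (k : nat) : nat :=
  #|[arg min_(D < [set: T] | k_max_deg k (~: D)) #|D|]|.

Lemma k_max_deg_setC_setT k : k_max_deg k (~: [set: T]).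
Proof. by rewrite /k_max_deg setCT cards0; case: k => //= k; rewrite orbT. Qed.

End Graph.

(* Main.v *)
Require Import Defs.
From mathcomp Require Import all_boot all_order all_algebra.
From mathcomp Require Import reals exp zify ring.
Import Order.TTheory GRing.Theory Num.Theory.

(** Write [m] for the integer part of the cube root of [n], so that
[n < (m + 1) ^ 3], and put [k' = k - 1], so that [2 * k' + 1 <= m] and the
budget is [(2 * k - 1) * m = m + k' * (m + m)] deletions.

Forests are sparse: a set [S] of vertices has degree sum at most [n + #|S|]
([sum_deg_in_le]).  Hence deleting the [m] vertices of largest degree leaves
maximum degree at most [(m + 1) ^ 2] ([delete_top]).

Now look at the [k] vertices of largest degree in the graph that remains.

- If their degrees differ by at most [m], trim each of the first [k'] of them
  down to the degree [d] of the last one by deleting some of its private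
  neighbours, those which are neither selected nor adjacent to another selected
  vertex.  In a forest any other selected vertex spoils at most one neighbour
  of a given vertex ([common_neighbour_le1]), so there are enough private
  neighbours as soon as [d >= k'].  This finishes at cost [k' * m]
  ([equatable_spread]).

- If [d < k'], deleting the first [k'] vertices leaves maximum degree less than
  [k'].  Deleting all vertices of maximum degree while there are at most [k'] of
  them lowers the maximum degree by one at cost at most [k'], so this case
  costs at most [k' * k'] altogether ([equatable_max_deg]), within [k' * m].

- Otherwise deleting the first [k'] vertices lowers the maximum degree by at
  least [m + 1].

Starting from [(m + 1) ^ 2], the third case can occur [m] times, leaving maximum
degree at most [m + 1]; one further occurrence would make the graph edgeless.
So the total after the initial [m] deletions is at most [k' * (m + m)]
([equatable_steps]). *)

(** * Selecting the largest values of a function *)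

Section TopSet.
Variables (T : finType) (f : T -> nat).

(** The threshold element [v] is kept apart from [S]: below, [S] is deleted or
trimmed while [v] supplies the target degree. *)
Lemma top_set (A : {set T}) i : i < #|A| ->
  exists (S : {set T}) (v : T),
    [/\ S \subset A, #|S| = i, v \in A :\: S,
        forall x, x \in S -> f v <= f x &
        forall y, y \in A :\: S -> f y <= f v].
Proof.
elim: i => [|i IHi] ltiA.
  have [v vA] := card_gt0P ltiA.
  case: (arg_maxnP f vA) => w wA maxw.
  exists set0, w; rewrite sub0set cards0 setD0; split=> // x.
  by rewrite inE.
have [S [v [SA cardS vAS vS vmax]]] := IHi (ltnW ltiA).
have [vA vNS] : v \in A /\ v \notin S by move: vAS; rewrite inE => /andP[].
have SvA : v |: S \subset A by rewrite subUset sub1set vA.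
have cardSv : #|v |: S| = i.+1 by rewrite cardsU1 vNS cardS.
have [u uASv] : exists u, u \in A :\: (v |: S).
  by apply/card_gt0P; rewrite cardsD (setIidPr SvA) cardSv subn_gt0.
case: (arg_maxnP f uASv) => w wASv maxw.
have wAS : w \in A :\: S.
  have : w \in A :\: (v |: S) := wASv.
  by rewrite !inE negb_or -andbA => /and3P[_ -> ->].
exists (v |: S), w; split=> // x.
by move=> /setU1P[->|/vS]; [|apply: leq_trans]; apply: vmax.
Qed.

End TopSet.

Lemma leq_card_bigcup (T I : finType) (J : {set I}) (F : I -> {set T}) :
  #|\bigcup_(i in J) F i| <= \sum_(i in J) #|F i|.
Proof.
elim/big_ind2: _ => [|A a B b Aa Bb|//]; first by rewrite cards0.
by rewrite (leq_trans (leq_card_setU _ _)) // leq_add.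
Qed.

(** * Deleting vertices to equate maximum degrees *)

Section Graph.
Variables (T : finType) (e : rel T).

Lemma deg_in_sub (A B : {set T}) x : A \subset B -> deg_in e A x <= deg_in e B x.
Proof.
move=> /subsetP AB; apply/subset_leq_card/subsetP => y.
by rewrite !inE => /andP[/AB -> ->].
Qed.

Lemma deg_in_setD1 (A : {set T}) v x : v \in A ->
  deg_in e A x = deg_in e (A :\ v) x + e x v.
Proof.
move=> vA; rewrite /deg_in (cardsD1 v) !inE vA addnC; congr (_ + _).
by apply: eq_card => y; rewrite !inE andbA.
Qed.

(** The budget-bounded form of [f_], for the induced subgraph on [A]: unlike the
minimum itself it composes well along successive deletions. *)
Definition equatable k c (A : {set T}) :=
  exists2 D : {set T}, #|D| <= c & k_max_deg e k (A :\: D).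

Lemma equatable_leq k c c' A : c <= c' -> equatable k c A -> equatable k c' A.
Proof. by move=> cc' [D cD kD]; exists D => //; apply: leq_trans cc'. Qed.

Lemma equatable_setD k c d (D A : {set T}) : #|D| <= d ->
  equatable k c (A :\: D) -> equatable k (d + c) A.
Proof.
move=> Dd [D' cD' kD']; exists (D :|: D'); last by rewrite -setDDl.
by rewrite (leq_trans (leq_card_setU _ _)) // leq_add.
Qed.

Lemma equatable0 k c A : k_max_deg e k A -> equatable k c A.
Proof. by exists set0; rewrite ?cards0 ?setD0. Qed.

Lemma equatable_small k c (A : {set T}) : #|A| < k -> equatable k c A.
Proof. by move=> Ak; apply: equatable0; rewrite /k_max_deg Ak orbT. Qed.

Lemma deg_in_le_max (A : {set T}) x : x \in A -> deg_in e A x <= max_deg e A.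
Proof. exact: (leq_bigmax_cond (F := deg_in e A)). Qed.

Lemma k_max_deg_edgeless k (A : {set T}) : max_deg e A = 0 -> k_max_deg e k A.
Proof.
move=> A0; rewrite /k_max_deg A0.
suff -> : [set x in A | deg_in e A x == 0] = A by rewrite leqNgt orNb.
apply/setP => x; rewrite inE andb_idr // => xA.
by rewrite -leqn0 -A0 deg_in_le_max.
Qed.

(** As long as at most [k] vertices attain the maximum degree, deleting them all
lowers that maximum; once it is [0], all the vertices share the same degree. *)
Lemma equatable_max_deg k (A : {set T}) : equatable k.+1 (k * max_deg e A) A.
Proof.
have [d] := ubnP (max_deg e A); elim: d A => // d IHd A Ad.
have [kA|kA] := boolP (k_max_deg e k.+1 A); first exact: equatable0.
have A_gt0 : 0 < max_deg e A.
  by rewrite lt0n; apply: contraNneq kA => /k_max_deg_edgeless.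
move: kA; rewrite negb_or -ltnNge ltnS => /andP[];
set M := [set x in A | _] => Mk Ak.
have M_drop : max_deg e (A :\: M) < max_deg e A.
  rewrite -(ltn_predK A_gt0) ltnS; apply/bigmax_leqP => x /setDP[xA xNM].
  rewrite -ltnS (ltn_predK A_gt0).
  apply: leq_ltn_trans (deg_in_sub _ _ x (subsetDl _ _)) _.
  by move: xNM; rewrite inE xA /= ltn_neqAle deg_in_le_max // => ->.
apply: (@equatable_leq _ (k + k * max_deg e (A :\: M))).
  by rewrite -mulnS leq_mul.
by apply: (equatable_setD _ _ _ M); [lia | apply: IHd; lia].
Qed.

Lemma f_le_equatable k c : equatable k c setT -> f_ e k <= c.
Proof.
case=> D cD; rewrite setTD => kD; rewrite /f_.
by case: arg_minnP => [|D' _ /(_ D kD) D'D];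
  [exact: k_max_deg_setC_setT | exact: leq_trans cD].
Qed.

(** * Structure of forests *)

Hypothesis forest_e : forest e.

Let sym_e : symmetric e. Proof. by case: forest_e => -[]. Qed.
Let irr_e : irreflexive e. Proof. by case: forest_e => -[]. Qed.
Let acyclic_e (c : seq T) : 3 <= size c -> ucycle e c -> False.
Proof. by case: forest_e => _; apply. Qed.

(** Two such vertices [y] would close a triangle (if one of them is [z]) or a
4-cycle through [x] and [z]. *)
Lemma common_neighbour_le1 (A : {set T}) x z : x != z ->
  #|[set y in A | e x y && ((y == z) || e z y)]| <= 1.
Proof.
move=> x_z; rewrite leqNgt; apply/negP => /card_gt1P [a [b [aP bP a_b]]].
have e_neq u v : e u v -> u != v.
  by apply: contraTneq => ->; rewrite irr_e.
wlog b_z : a b aP bP a_b / b != z.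
  move=> wl; have [bz|] := eqVneq b z; last exact: wl a_b.
  have b_a : b != a by rewrite eq_sym.
  by apply: wl bP aP b_a _; rewrite -bz.
move: aP bP; rewrite !inE => /andP[_ /andP[exa za]] /andP[_ /andP[exb]].
rewrite (negPf b_z) /= => ezb.
have [az|a_z] := eqVneq a z.
  apply: (@acyclic_e [:: x; z; b]) => //.
  rewrite /ucycle /= -{1}az exa ezb sym_e exb /= !inE negb_or x_z.
  by rewrite (e_neq x b) ?(e_neq z b).
move: za; rewrite (negPf a_z) /= => eza.
apply: (@acyclic_e [:: x; a; z; b]) => //.
rewrite /ucycle /= exa [e a z]sym_e eza ezb [e b x]sym_e exb /=.
by rewrite !inE !negb_or x_z a_z a_b !e_neq.
Qed.

(** If every vertex had two neighbours in [A], any path could be extended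
backwards from its first vertex by a neighbour other than the second vertex;
that neighbour is new since otherwise it would close a cycle.  So there would be
paths longer than the number of vertices. *)
Lemma exists_leaf (A : {set T}) : A != set0 -> exists2 v, v \in A & deg_in e A v <= 1.
Proof.
case/set0Pn => v0 v0A; apply/exists_inP; apply: contraT.
rewrite negb_exists_in => /forall_inP min2.
have long n : exists x p, [/\ path e x p, uniq (x :: p), all [in A] (x :: p)
                            & size p = n].
  elim: n => [|n [x [p [xp up Ap sp]]]].
    by exists v0, [::]; rewrite /= v0A.
  have xA : x \in A by case/andP: Ap.
  have /card_gt1P [a [b [+ + a_b]]] : 1 < deg_in e A x by rewrite ltnNge min2.
  rewrite !inE => /andP[aA exa] /andP[bA exb].
  (* For a one-vertex path, [head x p] is [x] itself, which is no neighbour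
     of [x], so nothing is excluded. *)
  have [y [yA exy yp]] : exists y, [/\ y \in A, e x y & y != head x p].
    have [ah|] := eqVneq a (head x p); last by exists a.
    by exists b; split=> //; rewrite -ah eq_sym.
  exists y, (x :: p); split=> /=; last by rewrite sp.
  - by rewrite sym_e exy.
  - rewrite -/(uniq (x :: p)) up andbT; apply/negP.
    rewrite inE; case/predU1P => [yx|yinp]; first by rewrite yx irr_e in exy.
    case/splitPr: yinp xp up yp {Ap sp} => p1 p2.
    rewrite cat_path /= => /and3P[xp1 ey _] up yp.
    apply: (@acyclic_e (x :: rcons p1 y)).
      by case: p1 yp {xp1 ey up} => [|? ?] /=; rewrite ?eqxx // size_rcons.
    apply/andP; split; first by rewrite /= !rcons_path last_rcons xp1 ey sym_e.
    have : uniq ((x :: rcons p1 y) ++ p2) by rewrite /= cat_rcons.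
    by rewrite cat_uniq => /andP[].
  - by rewrite yA.
have [x [p [_ /card_uniqP up _ sp]]] := long #|T|.
by have := max_card [in x :: p]; rewrite up /= sp ltnn.
Qed.

(** By induction, removing a leaf [v]: this lowers the sum by at most one, through
the only neighbour of [v], and by at most one more, its own degree, when [v] is
in [S]. *)
Lemma sum_deg_in_le (S A : {set T}) : S \subset A ->
  \sum_(x in S) deg_in e A x <= #|A| + #|S|.
Proof.
have [n] := ubnP #|A|; elim: n A S => // n IHn A S ltAn SA.
have [A0|/exists_leaf[v vA leaf_v]] := eqVneq A set0.
  by move: SA; rewrite A0 subset0 => /eqP->; rewrite big_set0.
have cA : #|A| = #|A :\ v|.+1 by rewrite (cardsD1 v) vA.
have := IHn (A :\ v) (S :\ v); rewrite setSD // => /(_ _ isT).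
rewrite -ltnS -cA => /(_ ltAn) IH.
have nbr : \sum_(x in S :\ v) e x v <= deg_in e A v.
  have -> : \sum_(x in S :\ v) e x v = #|[set x in S :\ v | e x v]|.
    by rewrite -sum1dep_card big_mkcondr; apply: eq_bigr => x _; case: (e x v).
  apply/subset_leq_card/subsetP => x; rewrite !inE sym_e => /andP[/andP[_ xS] ->].
  by rewrite (subsetP SA).
have split_sum : \sum_(x in S :\ v) deg_in e A x =
    \sum_(x in S :\ v) deg_in e (A :\ v) x + \sum_(x in S :\ v) e x v.
  by rewrite -big_split; apply: eq_bigr => x _; apply: deg_in_setD1.
have [vS|vNS] := boolP (v \in S).
  have cS : #|S| = #|S :\ v|.+1 by rewrite (cardsD1 v) vS.
  by rewrite (big_setD1 v) //= split_sum; lia.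
have SvE : S :\ v = S by apply/setDidPl; rewrite disjoint_sym disjoints1.
by rewrite SvE in nbr split_sum IH; rewrite split_sum; lia.
Qed.

(** * The cost of equating in a forest *)

(** The vertices of [S] are brought down to the degree of [v] by deleting private
neighbours.  Privacy ensures that trimming one selected vertex neither removes
another one nor changes its degree; the unselected vertices never
exceed the target degree. *)
Lemma equatable_spread k m (A S : {set T}) v :
    S \subset A -> #|S| = k -> v \in A :\: S ->
    {in S, forall x, deg_in e A x <= deg_in e A v + m} ->
    {in A :\: S, forall y, deg_in e A y <= deg_in e A v} ->
    {in S, forall x, deg_in e A v <= deg_in e A x} ->
  k <= deg_in e A v -> equatable k.+1 (k * m) A.
Proof.
move=> SA cS /setDP[vA vNS] spread vmax vmin kv.
set d := deg_in e A v in spread vmax vmin kv.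
pose U := v |: S.
have cU : #|U| = k.+1 by rewrite cardsU1 vNS cS.
have UA : U \subset A by rewrite subUset sub1set vA.
have Ud x : x \in U -> d <= deg_in e A x by case/setU1P => [->|/vmin].
pose N x := [set y in A | e x y].
(* The neighbours of [x] that [z] prevents from being private to [x]. *)
pose bad x z := [set y in A | e x y && ((y == z) || e z y)].
pose P x := N x :\: \bigcup_(z in U :\ x) bad x z.
have P_large x : x \in U -> deg_in e A x - d <= #|P x|.
  move=> xU; rewrite cardsD leq_sub2l //.
  apply: leq_trans (subset_leq_card (subsetIr _ _)) _.
  apply: leq_trans (leq_card_bigcup _ _ _ _) _.
  apply: leq_trans kv.
  have <- : #|U :\ x| = k by have := cardsD1 x U; rewrite xU cU => -[].
  rewrite -sum1_card leq_sum // => z /setD1P[z_x _].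
  by apply: common_neighbour_le1; rewrite eq_sym.
(* For [x = v] this set is empty, so [v] is treated like the members of [S]. *)
pose D x := [set y in take (deg_in e A x - d) (enum (P x))].
have cD x : x \in U -> #|D x| = deg_in e A x - d.
  move=> xU; rewrite cardsE (card_uniqP _) ?take_uniq ?enum_uniq //.
  by rewrite size_takel // -cardE P_large.
have DP x y : y \in D x -> y \in P x.
  by rewrite inE => /mem_take; rewrite mem_enum.
pose E := \bigcup_(x in U) D x.
have EN x y : x \in U -> y \in E -> e x y -> y \in D x.
  move=> xU /bigcupP[z zU yz] exy.
  have [->//|x_z] := eqVneq x z.
  have := DP _ _ yz; rewrite !inE => /and3P[/bigcupP + yA ezy]; case.
  by exists x; [rewrite in_setD1 x_z | rewrite !inE yA ezy exy orbT].
have UE x : x \in U -> x \notin E.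
  move=> xU; apply/bigcupP => -[z zU /DP].
  rewrite !inE => /and3P[/bigcupP + xA ezx]; case.
  exists x; last by rewrite !inE xA ezx eqxx.
  by rewrite in_setD1 xU andbT; apply: contraTneq ezx => ->; rewrite irr_e.
have degU x : x \in U -> deg_in e (A :\: E) x = d.
  move=> xU.
  have -> : deg_in e (A :\: E) x = #|N x :\: D x|.
    apply: eq_card => y; rewrite 2!inE [RHS]inE [y \in N x]inE.
    have [exy|] := boolP (e x y); last by rewrite !andbF.
    rewrite !andbT; congr (~~ _ && _); apply/idP/idP => [yE|yD].
      exact: EN.
    by apply/bigcupP; exists x.
  rewrite cardsD (setIidPr _) ?cD // ?subKn ?Ud //.
  by apply/subsetP => y /DP /setDP[].
have degNU x : x \in A :\: E -> deg_in e (A :\: E) x <= d.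
  case/setDP => xA xNE.
  have [/degU->//|xNU] := boolP (x \in U).
  apply: leq_trans (deg_in_sub _ _ x (subsetDl A E)) (vmax x _).
  by move: xNU; rewrite !inE negb_or xA andbT => /andP[].
exists E.
  apply: leq_trans (leq_card_bigcup _ _ _ _) _.
  rewrite (eq_bigr _ cD) big_setU1 //= subnn add0n -cS -sum_nat_const.
  by rewrite leq_sum // => x xS; rewrite leq_subLR spread.
have UAE : U \subset A :\: E.
  by apply/subsetP => x xU; rewrite !inE UE // (subsetP UA).
have maxd : max_deg e (A :\: E) = d.
  apply/eqP; rewrite eqn_leq; apply/andP; split; first exact/bigmax_leqP.
  have vU : v \in U by rewrite setU11.
  rewrite -{1}(degU v vU).
  by apply: (leq_bigmax_cond (F := deg_in e (A :\: E))); apply: (subsetP UAE).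
apply/orP; left; rewrite -cU maxd; apply/subset_leq_card/subsetP => x xU.
by rewrite inE (subsetP UAE) // degU /=.
Qed.

(** The trichotomy on the [k.+1] vertices of largest degree: [S] together with the
last one, [v]. *)
Lemma equatable_or_drop k m (A : {set T}) : k <= m ->
  equatable k.+1 (k * m) A \/
  exists2 S : {set T}, #|S| <= k & max_deg e (A :\: S) + m < max_deg e A.
Proof.
move=> km; have [/equatable_small|kA] := ltnP #|A| k.+1; first by left.
have [S [v [SA cS vAS vS vmax]]] := top_set _ (deg_in e A) A k kA.
have dropS : max_deg e (A :\: S) <= deg_in e A v.
  apply/bigmax_leqP => x /vmax; apply: leq_trans.
  exact/deg_in_sub/subsetDl.
(* When [v] has too small a degree to leave room for private neighbours,
   lowering the maximum degree one by one is cheap enough. *)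
have [kv|vk] := leqP k (deg_in e A v); last first.
  left; apply: (@equatable_leq _ (k + k * max_deg e (A :\: S))).
    by rewrite -mulnS leq_mul //; lia.
  by apply: equatable_setD (equatable_max_deg _ _); rewrite cS.
have [/forall_inP spread|] := boolP [forall x in S, deg_in e A x <= deg_in e A v + m].
  by left; apply: equatable_spread vAS _ _ _ _.
rewrite negb_forall_in => /exists_inP[y yS]; rewrite -ltnNge => far_y.
right; exists S; first by rewrite cS.
have := deg_in_le_max _ _ (subsetP SA y yS); lia.
Qed.

(** Each drop costs [k] and consumes [m.+1] of the maximum degree.  The base case
still allows one drop, after which no edge is left; this is what keeps the
bound at [m + j] rather than [m + j.+1]. *)
Lemma equatable_steps k m j (A : {set T}) : 0 < m -> k <= m ->
  max_deg e A <= j.+1 * m.+1 -> equatable k.+1 (k * (m + j)) A.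
Proof.
move=> m_gt0 km; elim: j A => [|j IHj] A Ad.
all: have [eqA|[S cS dropS]] := equatable_or_drop _ _ A km.
- by rewrite addn0.
- apply: (@equatable_leq _ (k + k * max_deg e (A :\: S))).
    by rewrite -mulnS leq_mul //; lia.
  exact: equatable_setD (equatable_max_deg _ _).
- by apply: equatable_leq eqA; rewrite leq_mul // leq_addr.
- rewrite addnS mulnS; apply: equatable_setD cS _; apply: IHj; lia.
Qed.

(** Otherwise these [m] vertices together with the largest remaining one would have
degree sum at least [m.+1 * t.+1], above the bound [#|T| + m.+1] for forests. *)
Lemma delete_top (m t : nat) : m < #|T| -> #|T| + m.+1 < m.+1 * t.+1 ->
  exists2 S : {set T}, #|S| = m & max_deg e (~: S) <= t.
Proof.
move=> mT lt_t.
have mT' : m < #|[set: T]| by rewrite cardsT.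
have [S [v [_ cS vNS vS vmax]]] := top_set _ (deg_in e setT) _ _ mT'.
exists S => //; apply/bigmax_leqP => x; rewrite -setTD => /vmax degx.
apply: leq_trans (deg_in_sub _ _ x (subsetDl _ _)) (leq_trans degx _).
rewrite leqNgt; apply/negP => vt.
have := sum_deg_in_le (v |: S) setT (subsetT _).
have vnS : v \notin S by case/setDP: vNS.
rewrite cardsU1 cS vnS cardsT.
have : #|v |: S| * t.+1 <= \sum_(x in v |: S) deg_in e setT x.
  rewrite -sum_nat_const leq_sum // => y /setU1P[->//|/vS].
  exact: leq_trans.
by rewrite cardsU1 cS vnS; lia.
Qed.

Lemma f_forest_le k m : 0 < m -> k <= m -> m < #|T| < m.+1 ^ 3 ->
  f_ e k.+1 <= (2 * k + 1) * m.
Proof.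
move=> m_gt0 km /andP[mT Tm].
have [|S cS Sdeg] := delete_top m (m.+1 * m.+1) mT.
  move: Tm; rewrite !expnS expn0 muln1; lia.
have -> : (2 * k + 1) * m = m + k * (m + m) by lia.
apply: f_le_equatable; apply: equatable_setD (eq_leq cS) _; rewrite setTD.
exact: equatable_steps.
Qed.

End Graph.

Local Open Scope ring_scope.

Theorem theorem3p3 (R : realType) (T : finType) (e : rel T) (n k : nat)
  (forest_e : forest e) (card_T : #|T| = n) (k_ge2 : (2 <= k)%N)
  (n_large : n%:R `^ (1 / 3) >= 2 * k%:R - 1 :> R) :
  (f_ e k)%:R <= (2 * k%:R - 1) * (Num.floor (n%:R `^ (1 / 3) : R))%:~R :> R.
Proof.
set r : R := _ `^ _ in n_large *.
have r_ge0 : 0 <= r by exact: powR_ge0.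
have r3 : r ^+ 3 = n%:R.
  by rewrite -powR_mulrn // -powRrM mul1r mulVf ?powRr1 // pnatr_eq0.
case: k => // k in k_ge2 n_large *.
have kE : 2 * k.+1%:R - 1 = (2 * k + 1)%:R :> R.
  by rewrite natrD natrM -natr1; ring.
rewrite kE in n_large *.
have [m mE] : exists m : nat, Num.floor r = m%:Z.
  by exists `|Num.floor r|%N; rewrite gez0_abs // floor_ge0.
have km : (2 * k + 1 <= m)%N.
  by rewrite -lez_nat -mE real_floor_ge_int ?num_real.
have mr : m%:R <= r by rewrite -[m%:R]/(m%:Z%:~R) -mE floor_le.
have rm : r < m.+1%:R.
  by have := floorD1_gt r; rewrite mE -natr1 intrD.
have Tm : (n < m.+1 ^ 3)%N by rewrite -(ltr_nat R) natrX -r3 ltrXn2r.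
have mT : (m ^ 3 <= n)%N by rewrite -(ler_nat R) natrX -r3 lerXn2r ?nnegrE.
rewrite mE -[m%:Z%:~R]/(m%:R) -natrM ler_nat.
apply: f_forest_le => //; [lia | lia |].
rewrite card_T Tm andbT (leq_trans _ mT) // !expnS; nia.
Qed.
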